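(* For all integers $n,k$ with $k\ge 1$ and $n\ge 2k$, the polynomial $$f_{(n-k,k),2}(q)=\sum_{\substack{T\in SYT((n-k,k))\\ |\mathrm{Des}(T)|=2}} q^{\mathrm{maj}(T)}$$ is symmetric and unimodal with central term $n$. That is, writing $f_{(n-k,k),2}(q)=\sum_{j} b_j q^j$, one has $b_j=b_{2n-j}$ for all $j$, and the sequence $(b_j)$ is unimodal.
   Context: For a partition $\lambda$ of $n$, $SYT(\lambda)$ denotes the set of standard Young tableaux of shape $\lambda$: fillings of the Ferrers diagram of $\lambda$ (row 1 on top, with $\lambda_1$ boxes, row 2 below it with $\lambda_2$ boxes, and so on, left-justified) with the numbers $1,\dots,n$, each used once, such that entries increase along rows to the right and down columns. The descent set $\mathrm{Des}(T)$ is the set of $j\in\{1,\dots,n-1\}$ such that $j$ lies in a strictly higher row than $j+1$, and $\mathrm{maj}(T)=\sum_{j\in \mathrm{Des}(T)} j$. A sequence of coefficients is unimodal if it is weakly increasing up to some index and weakly decreasing afterwards; the zero polynomial is regarded as (trivially) symmetric and unimodal. *)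

(* Defs.v *)
From HB Require Import structures.
From mathcomp Require Import all_boot all_order all_algebra.

Set Implicit Arguments.
Unset Strict Implicit.
Unset Printing Implicit Defensive.

Import Order.TTheory GRing.Theory Num.Theory.

Section Tableaux.

(* The list of parts; it is a partition when weakly decreasing. *)
Variable la : seq nat.

(* A box is a row index together with a column index in that row, both
   numbered from 0, row 0 being the top (highest) one. *)
Definition box := {i : 'I_(size la) & 'I_(nth 0 la i)}.

Definition row_of (c : box) : nat := tag c.
Definition col_of (c : box) : nat := tagged c.

(* 'I_n is {0, ..., n-1}: the number written in box c is [entry T c], i.e.
   the value of T at c shifted by one. *)
Definition filling := {ffun box -> 'I_(sumn la)}.

Definition entry (T : filling) (c : box) : nat := (T c).+1.

Definition SYT : {set filling} :=
  [set T : filling |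
    [&& [forall v : 'I_(sumn la), #|[set c : box | entry T c == v.+1]| == 1],
        [forall c : box, forall c' : box,
           (row_of c == row_of c') && (col_of c < col_of c')
             ==> (entry T c < entry T c')]
      & [forall c : box, forall c' : box,
           (col_of c == col_of c') && (row_of c < row_of c')
             ==> (entry T c < entry T c')]]].

(* Here j : 'I_n stands for itself, without shift; entries are at least 1 and
   at most n, so every descent satisfies 1 <= j <= n-1. *)
Definition Des (T : filling) : {set 'I_(sumn la)} :=
  [set j : 'I_(sumn la) |
    [exists c : box, exists c' : box,
       [&& entry T c == j, entry T c' == j.+1 & row_of c < row_of c']]].

Definition maj (T : filling) : nat := \sum_(j in Des T) j.

Definition maj_poly (d : nat) : {poly int} :=
  (\sum_(T in SYT | #|Des T| == d) 'X^(maj T))%R.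

End Tableaux.

(* Coefficients indexed by all integers, so that the symmetry below also says
   that the coefficients of index j > 2c vanish. *)
Definition coefz (p : {poly int}) (j : int) : int :=
  match j with
  | Posz m => (p`_m)%R
  | Negz _ => 0%R
  end.

Definition symmetric_about (c : nat) (p : {poly int}) : Prop :=
  forall j : int, coefz p j = coefz p ((2 * c)%N%:Z - j)%R.

Definition unimodal (p : {poly int}) : Prop :=
  exists m : nat,
    (forall i j : nat, i <= j -> j <= m -> (p`_i <= p`_j)%R) /\
    (forall i j : nat, m <= i -> i <= j -> (p`_j <= p`_i)%R).

(* Main.v *)
(* Write m = n - k. The word recording the row of each entry of a tableau with
   exactly two descents is 0^a 1^b 0^(s-a) 1^(k-b) 0^(m-s) with 0 < b < k <= s <= m
   and b <= a < s, and its major index is b + s + a. Summing over a, the j-th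
   coefficient counts the pairs (b, s) with 2b + s <= j < 2s + b. Hence its
   increment at j is the number of pairs with 2b + s = j minus the number of pairs
   with 2s + b = j. Each of these is the size of an explicit interval, and linear
   arithmetic shows that the increment is nonnegative for j <= n and changes sign
   under j |-> 2n + 1 - j. *)

Require Import Defs.
From HB Require Import structures.
From mathcomp Require Import all_boot all_order all_algebra.
From mathcomp Require Import zify.

Set Implicit Arguments.
Unset Strict Implicit.
Unset Printing Implicit Defensive.

Import Order.TTheory GRing.Theory Num.Theory.

(** * Counting in intervals of natural numbers *)

Lemma sum_nat_eq1 p q x : \sum_(p <= i < q) (i == x) = (p <= x < q).
Proof.
have -> : \sum_(p <= i < q) (i == x) = count_mem x (index_iota p q).
  by rewrite -sum1_count [RHS]big_mkcond; apply: eq_bigr => i _ /=; case: eqP.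
by rewrite count_uniq_mem ?iota_uniq // mem_index_iota.
Qed.

Lemma sum_nat_itv p q u v :
  \sum_(p <= i < q) (u <= i < v) = minn q v - maxn p u.
Proof.
elim: q => [|q IH]; first by rewrite big_geq //; lia.
have [lepq|ltqp] := leqP p q; last by rewrite big_geq //; lia.
by rewrite big_nat_recr //= IH; lia.
Qed.

(** * Symmetry and monotonicity of the pair counts *)

Section Counting.

Variables m k : nat.
Hypotheses (k_gt0 : 0 < k) (le_km : k <= m).

Definition maj_count (j : nat) : nat :=
  \sum_(1 <= b < k) \sum_(k <= s < m.+1) (b.*2 + s <= j < s.*2 + b).

(* The pair (b, s) contributes 1 exactly for 2b + s <= j < 2s + b: this interval
   starts, respectively stops, at the index counted below. *)
Definition starts (j : nat) : nat :=
  \sum_(1 <= b < k) \sum_(k <= s < m.+1) (b.*2 + s == j).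

Definition stops (j : nat) : nat :=
  \sum_(1 <= b < k) \sum_(k <= s < m.+1) (s.*2 + b == j).

(** Since b < k <= s, each interval from 2b + s to 2s + b is nonempty, so its indicator changes only
    at the two ends. The additive form avoids truncated subtraction. *)
Lemma maj_countS j : maj_count j.+1 + stops j.+1 = maj_count j + starts j.+1.
Proof.
rewrite -!big_split; apply: eq_big_nat => b ltb.
rewrite -!big_split; apply: eq_big_nat => s lts /=.
by lia.
Qed.

Lemma maj_count_eq0 j : (j == 0) || ((m + k).*2 <= j) -> maj_count j = 0.
Proof.
move=> j_out; rewrite /maj_count big_nat_cond big1 // => b; rewrite andbT => ltb.
by rewrite big_nat_cond big1 // => s; rewrite andbT => lts; lia.
Qed.

(** For fixed b only s = j - 2b is possible; solving k <= j - 2b <= m for b gives the interval. *)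
Lemma startsE j :
  starts j = minn k (uphalf (j.+1 - k)) - maxn 1 (uphalf (j - m)).
Proof.
rewrite -sum_nat_itv; apply: eq_big_nat => b ltb.
(* Truncation is harmless: s >= k > 0 excludes the value 0. *)
transitivity (\sum_(k <= s < m.+1) (s == j - b.*2)).
  by apply: eq_big_nat => s lts; lia.
by rewrite sum_nat_eq1; lia.
Qed.

Lemma stopsE j :
  stops j = minn m.+1 (uphalf j) - maxn k (uphalf (j.+1 - k)).
Proof.
rewrite -sum_nat_itv /stops exchange_big_nat; apply: eq_big_nat => s lts.
transitivity (\sum_(1 <= b < k) (b == j - s.*2)).
  by apply: eq_big_nat => b ltb; lia.
by rewrite sum_nat_eq1; lia.
Qed.

Lemma leq_stops_starts j : j <= m + k -> stops j <= starts j.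
Proof. by move=> lejn; rewrite startsE stopsE; lia. Qed.

(** Reflection turns each [uphalf] term into a constant minus itself unless a difference is
    truncated; hence the cases j < k, k <= j <= m and m < j. *)
Lemma starts_stops_antisym_le j : j <= m + k ->
  starts j + starts ((m + k).*2.+1 - j) = stops j + stops ((m + k).*2.+1 - j).
Proof.
move=> jn; rewrite !startsE !stopsE.
have -> : uphalf ((m + k).*2.+1 - j) = (m + k).+1 - uphalf j by lia.
have [kj|jk] := leqP k j; last first.
  have -> : uphalf (j.+1 - k) = 0 by lia.
  have : m < uphalf (((m + k).*2.+1 - j).+1 - k) by lia.
  have : k < uphalf (((m + k).*2.+1 - j) - m) by lia.
  have : uphalf j <= k by lia.
  move: (uphalf _) (uphalf _) (uphalf _) (uphalf _) => p q r t.
  by clear - k_gt0 le_km; lia.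
have -> : uphalf (((m + k).*2.+1 - j).+1 - k) = m.+2 - uphalf (j.+1 - k) by lia.
(* Linear bounds are collected first, so that the [uphalf] terms can then be generalized to plain
   variables. *)
have : 0 < uphalf (j.+1 - k) by lia.
have : uphalf (j.+1 - k) <= uphalf j by lia.
have : uphalf j < uphalf (j.+1 - k) + k by lia.
have : uphalf j <= m by lia.
have : uphalf j <= k -> uphalf (j.+1 - k) <= k by lia.
have [jm|mj] := leqP j m.
  have -> : uphalf (j - m) = 0 by lia.
  have : k < uphalf (((m + k).*2.+1 - j) - m) by lia.
  have : uphalf (j.+1 - k) + k <= m.+2 by lia.
  by move: (uphalf _) (uphalf _) (uphalf _) => p r q; clear - k_gt0 le_km; lia.
have -> : uphalf (((m + k).*2.+1 - j) - m) = k.+1 - uphalf (j - m) by lia.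
have : 0 < uphalf (j - m) by lia.
have : uphalf (j - m) <= uphalf (j.+1 - k) by lia.
have : uphalf (j - m) <= k by lia.
have : uphalf (j.+1 - k) + k <= m.+1 + uphalf (j - m) by lia.
have : uphalf (j.+1 - k) <= m.+1 by lia.
by move: (uphalf _) (uphalf _) (uphalf _) => p r q; clear - k_gt0 le_km; lia.
Qed.

Lemma starts_stops_antisym j : j <= (m + k).*2.+1 ->
  starts j + starts ((m + k).*2.+1 - j) = stops j + stops ((m + k).*2.+1 - j).
Proof.
move=> lej; have [|ltj] := leqP j (m + k); first exact: starts_stops_antisym_le.
have := @starts_stops_antisym_le ((m + k).*2.+1 - j); rewrite subKn // => H.
by rewrite addnC [RHS]addnC H //; lia.
Qed.

(** Induction from the common value 0 at both ends: the increments at j + 1 and at 2(m + k) - j are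
    opposite. *)
Lemma maj_count_sym j : j <= (m + k).*2 ->
  maj_count j = maj_count ((m + k).*2 - j).
Proof.
elim: j => [|j IH] ltj; first by rewrite !maj_count_eq0 // subn0 leqnn orbT.
have := maj_countS j; have := maj_countS ((m + k).*2 - j.+1).
have := starts_stops_antisym (leqW ltj).
have := IH (ltnW ltj); rewrite subSS subnSK //.
by move: maj_count starts stops => c A B; lia.
Qed.

Lemma maj_count_incr i j : i <= j -> j <= m + k -> maj_count i <= maj_count j.
Proof.
move=> leij; rewrite -(subnKC leij); elim: (j - i) => [|d IH]; first by rewrite addn0.
rewrite addnS => ltdn; apply: leq_trans (IH (ltnW ltdn)) _.
by have := leq_stops_starts ltdn; have := maj_countS (i + d); lia.
Qed.

Lemma maj_count_decr i j : m + k <= i -> i <= j -> maj_count j <= maj_count i.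
Proof.
move=> leni leij; have [lej|ltj] := leqP j (m + k).*2; last first.
  by rewrite [maj_count j]maj_count_eq0 // (ltnW ltj) orbT.
by rewrite (maj_count_sym lej) (@maj_count_sym i) ?maj_count_incr //; lia.
Qed.

End Counting.

Ltac if_lia := repeat match goal with
  | |- context [if ?b then _ else _] => destruct b eqn:?
  | H : context [if ?b then _ else _] |- _ => destruct b eqn:?
  end; lia.

(** * Standard tableaux with two rows *)

Section TwoRows.

Variables m k : nat.
Hypotheses (k_gt0 : 0 < k) (le_km : k <= m).

Local Notation la := [:: m; k].
Local Notation n := (sumn la).

Definition top_box (c : 'I_m) : box la :=
  existT _ (@Ordinal (size la) 0 isT) c.

Definition bot_box (c : 'I_k) : box la :=
  existT _ (@Ordinal (size la) 1 isT) c.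

Lemma box_ind (P : box la -> Prop) :
  (forall c, P (top_box c)) -> (forall c, P (bot_box c)) -> forall x, P x.
Proof.
move=> Ptop Pbot [[[|[|i]] lti] c] //.
- by rewrite (_ : existT _ _ _ = top_box c) // /top_box (bool_irrelevance lti isT).
- by rewrite (_ : existT _ _ _ = bot_box c) // /bot_box (bool_irrelevance lti isT).
Qed.

Lemma sumn_la : n = m + k. Proof. by rewrite /= addn0. Qed.

Lemma val_eq_inj (T : filling la) : injective T ->
  forall x y, T x = T y :> nat -> x = y.
Proof. by move=> injT x y /val_inj /injT. Qed.

Lemma SYT_P (T : filling la) :
  reflect [/\ injective T /\ (forall v : 'I_n, exists x, T x = v),
              forall c c' : 'I_m, c < c' -> T (top_box c) < T (top_box c'),
              forall c c' : 'I_k, c < c' -> T (bot_box c) < T (bot_box c') &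
              forall (c : 'I_m) (c' : 'I_k), c = c' :> nat ->
                T (top_box c) < T (bot_box c')]
          (T \in SYT la).
Proof.
rewrite inE; apply: (iffP and3P).
  case=> /forallP card1T /forallP rowT /forallP colT.
  have row x y : row_of x = row_of y -> col_of x < col_of y -> T x < T y.
    move=> rxy cxy; have /forallP/(_ y) := rowT x.
    by rewrite rxy eqxx cxy /= /entry ltnS.
  have col x y : col_of x = col_of y -> row_of x < row_of y -> T x < T y.
    move=> rxy cxy; have /forallP/(_ y) := colT x.
    by rewrite rxy eqxx cxy /= /entry ltnS.
  split.
  - split=> [x y Txy|v]; last first.
      have /cards1P[x /setP/(_ x)] := card1T v.
      rewrite !inE eqxx /entry eqSS => /eqP Tx.
      by exists x; apply: val_inj.
    have /cards1P[z /setP Ez] := card1T (T x).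
    have := Ez x; rewrite !inE /entry eqxx => /esym/eqP ->.
    by have := Ez y; rewrite !inE /entry Txy eqxx => /esym/eqP ->.
  - by move=> c c' ltc; apply: row.
  - by move=> c c' ltc; apply: row.
  - by move=> c c' ecc; apply: col.
case=> [[injT surT] topT botT colT]; split.
- apply/forallP => v; have [x <-] := surT v.
  apply/cards1P; exists x; apply/setP=> y; rewrite !inE /entry eqSS.
  by apply/eqP/eqP => [/val_eq_inj-> | ->].
- apply/forallP; apply: box_ind => c; apply/forallP; apply: box_ind => c';
    apply/implyP => /andP[] //= _ ltc; rewrite /entry ltnS; by [apply: topT|apply: botT].
- apply/forallP; apply: box_ind => c; apply/forallP; apply: box_ind => c';
    apply/implyP => /andP[] //= /eqP ec _; rewrite /entry ltnS; exact: colT.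
Qed.

(** Entries exceed the values of [T] by one, so a descent j is the value of [T] at the bottom box
    with entry j + 1. *)
Lemma DesP (T : filling la) (j : 'I_n) :
  reflect (exists c c', T (bot_box c') = j /\ (T (top_box c)).+1 = j :> nat)
          (j \in Des T).
Proof.
rewrite inE; apply: (iffP existsP).
  case; apply: box_ind => c /existsP[]; apply: box_ind => c' /and3P[] //.
  rewrite /entry eqSS => /eqP e1 /eqP e2 _.
  by exists c, c'; split=> //; apply: val_inj.
case=> c [c' [e1 e2]]; exists (top_box c); apply/existsP; exists (bot_box c').
by rewrite /entry e2 e1 !eqxx.
Qed.

(** The top row must list the remaining values in increasing order. *)
Lemma SYT_bot_inj (T T' : filling la) : T \in SYT la -> T' \in SYT la ->
  (forall c, T (bot_box c) = T' (bot_box c)) -> T = T'.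
Proof.
move=> TY TY' eq_bot; apply/ffunP; apply: box_ind => // c.
(* If U were smaller than U' at d, its value there would occur in U' before d in the top row, or in
   the bottom row; U has the same value at that box, against injectivity. *)
have half (U U' : filling la) (d : 'I_m) : U \in SYT la -> U' \in SYT la ->
    (forall c, U (bot_box c) = U' (bot_box c)) ->
    (forall e : 'I_m, e < d -> U (top_box e) = U' (top_box e)) ->
  U' (top_box d) <= U (top_box d).
  move=> /SYT_P[[injU _] _ _ _] /SYT_P[[_ surU'] topU' _ _] ebot etop.
  rewrite leqNgt; apply/negP => ltU.
  have [x Ux] := surU' (U (top_box d)); elim/box_ind: x Ux => e.
    move=> Ue; have led : e < d.
      rewrite ltnNge; apply/negP; rewrite leq_eqVlt => /orP[/eqP/val_inj E|].
        by move: ltU; rewrite -Ue E ltnn.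
      by move/topU' => /(ltn_trans ltU); rewrite Ue ltnn.
    move: Ue; rewrite -etop // => /injU /(congr1 (@col_of la)) E.
    by move: led; rewrite (E : e = d :> nat) ltnn.
  by rewrite -ebot => /injU.
move: {2}(c : nat) (leqnn c) => N; elim: N c => [|N IH] c lecN.
  by apply/val_inj/eqP; rewrite eqn_leq !half // => e; rewrite ltnNge; lia.
apply/val_inj/eqP; rewrite eqn_leq !half // => e lec; rewrite IH //; lia.
Qed.

(** The top boxes in columns 0 to c and the bottom boxes before column c hold 2c + 1 distinct
    smaller values. *)
Lemma ballot (T : filling la) (c : 'I_k) : T \in SYT la ->
  c.*2 < T (bot_box c).
Proof.
case/SYT_P=> [[injT _] topT botT colT].
pose f (x : 'I_c.+1 + 'I_c) : box la := match x with
  | inl i => top_box (widen_ord (leq_trans (ltn_ord c) le_km) i)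
  | inr i => bot_box (widen_ord (ltnW (ltn_ord c)) i) end.
have f_lt x : T (f x) < T (bot_box c).
  case: x => i /=; last by apply: botT => /=.
  set d := widen_ord _ _; case: (ltngtP d c) => [ltdc||]; last exact: colT.
    apply: ltn_trans (botT (Ordinal (ltn_trans ltdc (ltn_ord c))) _ _) => //.
    by apply: colT.
  by rewrite /= ltnNge -ltnS ltn_ord.
have := @leq_card _ _ (fun x => Ordinal (f_lt x)).
rewrite card_sum !card_ord addSn addnn; apply => x y [] /val_eq_inj -/(_ injT).
by case: x y => [i|i] [j|j] //= []; [move/val_inj-> | move/val_inj->].
Qed.

(** * Tableaux with prescribed runs *)

Lemma n_gt0 : 0 < n. Proof. by rewrite sumn_la addn_gt0 k_gt0 orbT. Qed.

(** The column condition gives b <= a and k <= s; the bounds 0 < b < k and a < s make both descents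
    occur. *)
Definition runs (b s a : nat) : bool :=
  [&& 0 < b, b < k, k <= s, s <= m, b <= a & a < s].

(** The position, counted from 0, of the letter of the row word that places box x. *)
Definition run_entry (b s a : nat) (x : box la) : nat :=
  let c := col_of x in
  if row_of x == 0 then
    if c < a then c else if c < s then c + b else c + k
  else if c < b then a + c else s + c.

(* When runs b s a holds, every run_entry is below n and the default of insubd
   is not used. *)
Definition run_filling (b s a : nat) : filling la :=
  [ffun x => insubd (Ordinal n_gt0) (run_entry b s a x)].

Lemma run_top b s a (c : 'I_m) : runs b s a ->
  run_filling b s a (top_box c) =
    (if c < a then c : nat else if c < s then c + b else c + k) :> nat.
Proof.
move=> R; rewrite ffunE val_insubd ifT //; rewrite sumn_la /run_entry /=.
by have := ltn_ord c; move: R; rewrite /runs /col_of /=; if_lia.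
Qed.

Lemma run_bot b s a (c : 'I_k) : runs b s a ->
  run_filling b s a (bot_box c) = (if c < b then a + c else s + c) :> nat.
Proof.
move=> R; rewrite ffunE val_insubd ifT //; rewrite sumn_la /run_entry /=.
by have := ltn_ord c; move: R; rewrite /runs /col_of /=; if_lia.
Qed.

Lemma run_SYT b s a : runs b s a -> run_filling b s a \in SYT la.
Proof.
move=> R; have R' := R; rewrite /runs in R'.
apply/SYT_P; split.
- split.
    have eq_top (c c' : 'I_m) : c = c' :> nat -> top_box c = top_box c' by move/val_inj->.
    have eq_bot (c c' : 'I_k) : c = c' :> nat -> bot_box c = bot_box c' by move/val_inj->.
    apply: box_ind => c; apply: box_ind => c' /(congr1 val) /=;
      rewrite ?run_top ?run_bot //; have := ltn_ord c; have := ltn_ord c';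
      [| | |] => *; first [apply: eq_top | apply: eq_bot | exfalso]; if_lia.
  move=> v; have := ltn_ord v; rewrite {2}sumn_la => ltv.
  have top i : i < m -> (if i < a then i : nat else if i < s then i + b else i + k) = v ->
      exists x, run_filling b s a x = v.
    by move=> lti E; exists (top_box (Ordinal lti)); apply: val_inj; rewrite /= run_top.
  have bot i : i < k -> (if i < b then a + i else s + i) = v ->
      exists x, run_filling b s a x = v.
    by move=> lti E; exists (bot_box (Ordinal lti)); apply: val_inj; rewrite /= run_bot.
  (* One case for each of the five blocks of the word. *)
  case: (ltnP v a) => v1; first by apply: (top v); if_lia.
  case: (ltnP v (a + b)) => v2; first by apply: (bot (v - a)); if_lia.
  case: (ltnP v (s + b)) => v3; first by apply: (top (v - b)); if_lia.
  case: (ltnP v (s + k)) => v4; first by apply: (bot (v - s)); if_lia.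
  by apply: (top (v - k)); if_lia.
- by move=> c c' ltc; rewrite !run_top //; if_lia.
- by move=> c c' ltc; rewrite !run_bot //; if_lia.
- by move=> c c' ec; rewrite run_top // run_bot // ec; have := ltn_ord c'; if_lia.
Qed.

Lemma Des_run b s a (j : 'I_n) : runs b s a ->
  (j \in Des (run_filling b s a)) = ((j == a :> nat) || (j == s + b :> nat)).
Proof.
move=> R; have R' := R; rewrite /runs in R'.
apply/DesP/orP => [[c [c' [/(congr1 val) /=]]]|].
  rewrite run_top // run_bot // => e1 e2.
  by have := ltn_ord c; have := ltn_ord c'; if_lia.
have get i i' : i < m -> i' < k ->
    (if i' < b then a + i' else s + i') = j ->
    (if i < a then i : nat else if i < s then i + b else i + k).+1 = j ->
    exists c c', run_filling b s a (bot_box c') = j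
      /\ (run_filling b s a (top_box c)).+1 = j :> nat.
  move=> lti lti' e e'; exists (Ordinal lti), (Ordinal lti').
  by split; [apply: val_inj; rewrite /= run_bot | rewrite run_top].
(* The first two top blocks end in columns a - 1 and s - 1; the bottom blocks after them start in
   columns 0 and b. *)
case=> /eqP ej; first by apply: (get a.-1 0); if_lia.
by apply: (get s.-1 b); if_lia.
Qed.

Lemma Des_runE b s a : runs b s a ->
  exists2 ij : 'I_n * 'I_n, ij.1 != ij.2 /\ Des (run_filling b s a) = [set ij.1; ij.2]
    & ij.1 + ij.2 = b + s + a.
Proof.
move=> R; have R' := R; rewrite /runs in R'.
have lta : a < n by rewrite sumn_la; lia.
have ltsb : s + b < n by rewrite sumn_la; lia.
exists (Ordinal lta, Ordinal ltsb) => /=; last by lia.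
split; first by rewrite -val_eqE /=; lia.
by apply/setP => j; rewrite Des_run // !inE -!val_eqE.
Qed.

Lemma card_Des_run b s a : runs b s a -> #|Des (run_filling b s a)| = 2.
Proof. by case/Des_runE=> [[i j] /= [nij ->]] _; rewrite cards2 nij. Qed.

Lemma maj_run b s a : runs b s a -> maj (run_filling b s a) = b + s + a.
Proof.
case/Des_runE=> [[i j] /= [nij E] <-].
by rewrite /maj E big_setU1 ?inE // big_set1.
Qed.

(** The bottom row reveals the parameters: it starts with a, and as a < s its only jump is at column
    b, to s + b. *)
Lemma run_filling_inj b s a b' s' a' : runs b s a -> runs b' s' a' ->
  run_filling b s a = run_filling b' s' a' -> [/\ b = b', s = s' & a = a'].
Proof.
move=> R R' E.
have Ei i : i < k -> (if i < b then a + i else s + i) = (if i < b' then a' + i else s' + i).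
  move=> lti; have := congr1 (fun T : filling la => T (bot_box (Ordinal lti)) : nat) E.
  by rewrite /= !run_bot.
move: (Ei 0) (Ei b) (Ei b') R R'; rewrite /runs => *; split; if_lia.
Qed.

(** * Tableaux with exactly two descents *)

(* Only at a descent can a bottom entry fail to continue the previous one. *)
Lemma bot_succ (T : filling la) (c : 'I_k) : T \in SYT la ->
  T (bot_box c) \notin Des T ->
  exists2 c' : 'I_k, c'.+1 = c & T (bot_box c) = (T (bot_box c')).+1 :> nat.
Proof.
move=> TY nD; case/SYT_P: (TY) => [[injT surT] topT botT colT].
have v_gt0 := leq_ltn_trans (leq0n _) (ballot c TY).
have ltp : (T (bot_box c)).-1 < n by rewrite prednK // ltnW.
(* The preceding value in the top row would make a descent; in the bottom row, monotonicity forces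
   the preceding column. *)
have [x Tx] := surT (Ordinal ltp); elim/box_ind: x Tx => d /(congr1 val) /= Td.
  by case/DesP: nD; exists d, c; rewrite Td prednK.
have Tdc : T (bot_box c) = (T (bot_box d)).+1 :> nat by rewrite Td prednK.
exists d => //; case: (ltngtP d.+1 c) => // [ltdc|].
  have h1 := botT d (Ordinal (ltn_trans ltdc (ltn_ord c))) (ltnSn _).
  by have h2 := botT (Ordinal (ltn_trans ltdc (ltn_ord c))) c ltdc; lia.
rewrite ltnS leq_eqVlt => /orP[/eqP/val_inj E|/botT]; last by lia.
by move: Tdc; rewrite E; lia.
Qed.

(** One descent is the first bottom value; the other sits in a bottom column b, the only place where
    consecutiveness can break. Thus a is the first bottom value and s + b the one in column b. *)
Lemma SYT_runs (T : filling la) : T \in SYT la -> #|Des T| = 2 ->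
  exists b s a, runs b s a /\ T = run_filling b s a.
Proof.
move=> TY /eqP/cards2P[d1 [d2 [nd ED]]].
case/SYT_P: (TY) => [[injT surT] topT botT colT].
pose c0 : 'I_k := Ordinal k_gt0.
(* From k on, [v] falls back to column 0, so the facts below bound their indices by k. *)
pose v i := T (bot_box (insubd c0 i)) : nat.
have vE (c : 'I_k) : T (bot_box c) = v c :> nat by rewrite /v valKd.
have v_mono i j : i < j -> j < k -> v i < v j.
  by move=> ij jk; apply: botT; rewrite !val_insubd jk (ltn_trans ij jk).
have v0D : T (bot_box c0) \in Des T.
  by apply/negPn/negP => /(bot_succ TY)[].
have [d [dD nd0 D_only]] : exists d, [/\ d \in Des T, d != T (bot_box c0) &
    forall e, e \in Des T -> e = d \/ e = T (bot_box c0)].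
  have [E|n1] := eqVneq d1 (T (bot_box c0)).
    exists d2; rewrite ED !inE -E (eq_sym d2) nd eqxx orbT; split=> // e.
    by rewrite !inE => /orP[]/eqP; [right|left].
  have E : d2 = T (bot_box c0).
    by move: v0D; rewrite ED !inE eq_sym (negPf n1) => /eqP.
  exists d1; rewrite ED !inE n1 eqxx; split=> // e.
  by rewrite -E !inE => /orP[]/eqP; [left|right].
have [t [b [vb ut]]] := DesP _ _ dD.
have b_gt0 : 0 < b.
  rewrite lt0n; apply: contra nd0 => /eqP b0.
  by rewrite -vb; apply/eqP; congr (T (bot_box _)); apply: val_inj.
have ltbk := ltn_ord b.
have vS i : i.+1 < k -> i.+1 != b -> v i.+1 = (v i).+1.
  move=> ltik nib; have E := vE (Ordinal ltik); rewrite /= in E.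
  have [|c' /= [ec']] := @bot_succ T (Ordinal ltik) TY.
    2: by rewrite E vE ec'.
  apply/negP=> /D_only[]; rewrite -?vb => /injT /(congr1 (@col_of la)).
    by move=> ib; case/eqP: nib.
  by [].
have v_lo i : i < b -> v i = v 0 + i.
  elim: i => [|i IH] lti; first by rewrite addn0.
  by rewrite vS ?IH ?addnS //; lia.
have v_hi i : b + i < k -> v (b + i) = v b + i.
  elim: i => [|i IH] lti; first by rewrite !addn0.
  by rewrite addnS vS ?IH ?addnS //; lia.
have ball i : i < k -> i.*2 < v i.
  by move=> ltik; have := ballot (Ordinal ltik) TY; rewrite vE.
(* Otherwise the value just below v b would lie both in the top box t and in bottom column b - 1. *)
have v_jump : v b != v 0 + b.
  apply/eqP => E; have ltb1 : b.-1 < k by lia.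
  suff /val_inj/injT : T (top_box t) = T (bot_box (Ordinal ltb1)) :> nat by [].
  by apply: succn_inj; rewrite vE /= v_lo ?prednK // ut -vb vE E -addnS prednK.
(* The ballot bounds in columns b - 1 and k - 1 give b <= a and k <= s; the largest bottom value
   gives s <= m; the jump gives a < s. *)
have Eb1 := v_lo b.-1; have ball1 := ball b.-1; have vb1 := v_mono b.-1 b.
have Ek1 := v_hi (k.-1 - b); have ballk := ball k.-1.
have ltvn : v k.-1 < n by exact: ltn_ord.
have ek : b + (k.-1 - b) = k.-1 by lia.
rewrite ek in Ek1; rewrite sumn_la in ltvn.
have R : runs b (v b - b) (v 0) by rewrite /runs; lia.
exists b, (v b - b), (v 0); split=> //.
apply: SYT_bot_inj => //; first exact: run_SYT.
move=> c; apply: val_inj; rewrite /= run_bot // vE.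
case: ltnP => [/v_lo //|lebc].
by have := v_hi (c - b); rewrite subnKC // => -> //; lia.
Qed.

(** * From tableaux to coefficients *)

Local Open Scope ring_scope.

Lemma coef_maj_poly j : (maj_poly la 2)`_j = (maj_count m k j)%:R.
Proof.
pose I := ('I_k * 'I_m.+1 * 'I_m)%type.
pose h (t : I) := run_filling t.1.1 t.1.2 t.2.
pose R := [set t : I | runs t.1.1 t.1.2 t.2].
have ER : [set T in SYT la | #|Des T| == 2%N] = h @: R.
  apply/setP => T; rewrite inE; apply/andP/imsetP => [[TY /eqP dT]|[t]].
    have [b [s [a [Rt ->]]]] := SYT_runs TY dT.
    have [ltb lts lta] : [/\ b < k, s < m.+1 & a < m]%N.
      by move: Rt; rewrite /runs => *; split; lia.
    by exists (Ordinal ltb, Ordinal lts, Ordinal lta); rewrite ?inE.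
  by rewrite inE => Rt ->; rewrite run_SYT ?card_Des_run.
have h_inj : {in R &, injective h}.
  move=> [[b s] a] [[b' s'] a']; rewrite !inE => Rt Rt' /(run_filling_inj Rt Rt').
  by case=> /= /val_inj-> /val_inj-> /val_inj->.
rewrite /maj_poly.
have -> : \sum_(T in SYT la | #|Des T| == 2%N) 'X^(maj T) =
    \sum_(t in R) 'X^(t.1.1 + t.1.2 + t.2) :> {poly int}.
  transitivity (\sum_(T in h @: R) 'X^(maj T) : {poly int}).
    by apply: eq_bigl => T; rewrite -ER [RHS]in_set.
  rewrite big_imset //=; apply: eq_bigr => t; rewrite inE => Rt.
  by rewrite maj_run.
rewrite coef_sum (eq_bigr _ (fun t _ => coefXn _ _ _)) -natr_sum; congr (_%:R).
rewrite /maj_count big_geq_mkord.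
transitivity (\sum_(b < k) \sum_(s < m.+1) \sum_(a < m)
    if runs b s a then (j == b + s + a :> nat) : nat else 0)%N.
  rewrite pair_bigA pair_bigA big_mkcond /=.
  by apply: eq_bigr => t _; rewrite inE.
rewrite [RHS]big_mkcond; apply: eq_bigr => b _.
have [b_gt0|b0] := ltnP 0 b; last first.
  by rewrite big1 // => s _; rewrite big1 // => a _; rewrite ifF // /runs; lia.
rewrite big_geq_mkord [RHS]big_mkcond; apply: eq_bigr => s _.
have [ks|sk] := leqP k s; last first.
  by rewrite big1 // => a _; rewrite ifF // /runs; lia.
have [ltb lts] := (ltn_ord b, ltn_ord s).
(* The only candidate is a = j - b - s, for which b <= a < s reads 2b + s <= j < 2s + b. *)
case: ifP => [jbs|jbs]; last first.
  by rewrite big1 // => a _; case: ifP => //; rewrite /runs; lia.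
have lta : (j - b - s < m)%N by lia.
rewrite (bigD1 (Ordinal lta)) //= big1 ?addn0.
  by rewrite ifT /runs; lia.
by move=> a; rewrite -val_eqE /=; case: ifP => //; rewrite /runs; lia.
Qed.

End TwoRows.

Theorem theorem2 (n k : nat) (hk : 1 <= k) (hn : 2 * k <= n) :
  symmetric_about n (maj_poly [:: n - k; k] 2) /\
  unimodal (maj_poly [:: n - k; k] 2).
Proof.
have le_km : k <= n - k by lia.
have nE : n - k + k = n by lia.
have coefE := coef_maj_poly hk le_km.
split.
  (* Indices above 2n mirror the negative ones, where [coefz] is 0. *)
  have coef_out j : n.*2 < j -> ((maj_poly [:: (n - k)%N; k] 2)`_j = 0)%R.
    by move=> ltj; rewrite coefE maj_count_eq0 // nE (ltnW ltj) orbT.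
  case=> [j|j]; last first.
    rewrite (_ : (_ - _)%R = Posz (n.*2 + j.+1)) /=; last by lia.
    by rewrite coef_out //; lia.
  have [lej|ltj] := leqP j n.*2.
    rewrite (_ : (_ - _)%R = Posz (n.*2 - j)) /=; last by lia.
    by rewrite !coefE (maj_count_sym hk le_km) nE.
  rewrite (_ : (_ - _)%R = Negz (j - n.*2).-1) /=; last by lia.
  exact: coef_out.
exists n; split=> i j leij lejn; rewrite !coefE ler_nat.
  by apply: maj_count_incr; rewrite ?nE.
by apply: maj_count_decr; rewrite ?nE.
Qed.
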